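(* The internal operad construction $\mathcal{A}\mapsto\mathcal{I}_{\mathcal{A}}$ is left adjoint to the functor from the category of closed braided operads to the category of extensional $\mathbf{BC^\pm I}$-algebras sending $\mathcal{P}$ to $\mathcal{P}(0)$.
   Context: Applicative structure: a set with binary application written by juxtaposition, left associative; $a\circ b:=\mathbf{B}\,a\,b$. An extensional $\mathbf{BC^\pm I}$-algebra has elements $\mathbf{B},\mathbf{C}^+,\mathbf{C}^-,\mathbf{I}$ such that for all $a,b,c$, all $\star,\varepsilon\in\{+,-\}$: $\mathbf{B}\,a\,b\,c=a\,(b\,c)$; $\mathbf{C}^\star\,a\,b\,c=a\,c\,b$; $\mathbf{I}\,a=a$; $\mathbf{C}^+\,a\,b=\mathbf{C}^-\,a\,b$; $\mathbf{B}\,\mathbf{I}=\mathbf{I}$; $\mathbf{C}^\star\,\mathbf{B}\,\mathbf{I}=\mathbf{I}$; $(\mathbf{B}\,\mathbf{B})\circ\mathbf{B}=(\mathbf{C}^\star\,\mathbf{B}\,\mathbf{B})\circ(\mathbf{B}\circ\mathbf{B})$; $\mathbf{C}^\varepsilon\circ\mathbf{C}^{-\varepsilon}=\mathbf{I}$; $(\mathbf{B}\,\mathbf{C}^\varepsilon)\circ(\mathbf{B}\circ\mathbf{B})=(\mathbf{C}^\star\,\mathbf{B}\,\mathbf{C}^\varepsilon)\circ(\mathbf{B}\circ\mathbf{B})$; $(\mathbf{B}\,\mathbf{C}^\varepsilon)\circ(\mathbf{C}^\varepsilon\circ(\mathbf{B}\,\mathbf{C}^\varepsilon))=\mathbf{C}^\varepsilon\circ((\mathbf{B}\,\mathbf{C}^\varepsilon)\circ\mathbf{C}^\varepsilon)$;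 $(\mathbf{B}\,\mathbf{B})\circ\mathbf{C}^\varepsilon=\mathbf{C}^\varepsilon\circ((\mathbf{B}\,\mathbf{C}^\varepsilon)\circ\mathbf{B})$. Morphisms preserve application and $\mathbf{B},\mathbf{C}^\pm,\mathbf{I}$. Put $a^\bullet=\mathbf{C}^+\,\mathbf{I}\,a$, $\mathbf{B}^0=\mathbf{I}$, $\mathbf{B}^{k+1}=\mathbf{B}\circ\mathbf{B}^k$. Internal operad: $\mathcal{I}_{\mathcal{A}}(m)=\{a^\bullet\circ\mathbf{B}^m\mid a\in\mathcal{A}\}$, identity $\mathbf{I}$, $\mathbf{app}=\mathbf{B}$, $g(f_1,\dots,f_n)=f_1\circ(\mathbf{B}\,f_2)\circ\cdots\circ(\mathbf{B}^{n-1}f_n)\circ g$; it carries a closed braided operad structure. Braided operad: an operad with right actions of the Artin braid groups $B_j$ on $\mathcal{P}(j)$ satisfying $(fs)(g_1,\dots,g_k)=(f(g_{s^{-1}(1)},\dots,g_{s^{-1}(k)}))\,s[j_1,\dots,j_k]$ ($s$ acting on indices via its underlying permutation; $s[j_1,\dots,j_k]$ replaces the $m$-th strand by $j_m$ parallel strands) and $f(g_1t_1,\dots,g_kt_k)=(f(g_1,\dots,g_k))(t_1\oplus\dots\oplus t_k)$ ($\oplus$ block sum of braids). Closed: $\mathbf{app}\in\mathcal{P}(2)$ with each $p\in\mathcal{P}(n+1)$ having a unique $\lambda(p)\in\mathcal{P}(n)$ with $\mathbf{app}(\lambda(p),\mathit{id})=p$. Morphisms preserve identity, composition, braid actions and $\mathbf{app}$.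 $\mathcal{P}(0)$ is an extensional $\mathbf{BC^\pm I}$-algebra with $a\,b=\mathbf{app}(a,b)$ and combinators obtained by $\lambda$-abstraction of the corresponding operations (with $\mathbf{C}^\pm$ obtained using the braid generator $\sigma_1^{\pm1}$). *)

(* Defs.v *)
From mathcomp Require Import all_boot all_order all_fingroup.
From mathcomp Require Import boolp.

Set Implicit Arguments.
Unset Strict Implicit.
Unset Printing Implicit Defensive.
Local Obligation Tactic := idtac.

Record category := Category {
  ob :> Type;
  hom : ob -> ob -> Type;
  idm : forall c, hom c c;
  comp : forall c d e, hom d e -> hom c d -> hom c e;
  comp1m : forall c d (f : hom c d), comp (idm d) f = f;
  compm1 : forall c d (f : hom c d), comp f (idm c) = f;
  compA : forall c d e e' (h : hom e e') (g : hom d e) (f : hom c d),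
    comp h (comp g f) = comp (comp h g) f }.

Record functor (C D : category) := Functor {
  fob :> C -> D;
  fmap : forall c d, hom c d -> hom (fob c) (fob d);
  fmap_id : forall c, fmap (idm c) = idm (fob c);
  fmap_comp : forall c d e (g : hom d e) (f : hom c d),
    fmap (comp g f) = comp (fmap g) (fmap f) }.

Definition left_adjoint (C D : category) (F : functor C D) (G : functor D C) :
    Prop :=
  exists phi : forall c d, hom (F c) d -> hom c (G d),
  [/\ forall c d, bijective (@phi c d),
      forall c c' d (f : hom (F c) d) (u : hom c' c),
        phi c' d (comp f (fmap F u)) = comp (phi c d f) u &
      forall c d d' (v : hom d d') (f : hom (F c) d),
        phi c d' (comp v f) = comp (fmap G v) (phi c d f)].

(** [cC true] and [cC false] are the combinators C^+ and C^-. *)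
Record bci_data := BciData {
  carrier :> Type;
  app : carrier -> carrier -> carrier;
  cB : carrier;
  cC : bool -> carrier;
  cI : carrier }.

Arguments cB {_}.
Arguments cC {_}.
Arguments cI {_}.

Declare Scope bci_scope.
Delimit Scope bci_scope with bci.
Local Open Scope bci_scope.

Notation "a · b" := (app a b)
  (at level 40, left associativity) : bci_scope.
Notation "a ∘ b" := (cB · a · b)
  (at level 41, right associativity) : bci_scope.
Notation "a ^•" := (cC true · cI · a) (at level 2, format "a ^•") : bci_scope.

Record is_extensional_bci (A : bci_data) : Prop := IsExtensionalBci {
  appB : forall a b c : A, cB · a · b · c = a · (b · c);
  appC : forall (s : bool) (a b c : A), cC s · a · b · c = a · c · b;
  appI : forall a : A, cI · a = a;
  appC_sign : forall a b : A, cC true · a · b = cC false · a · b;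
  BI : cB · cI = cI :> A;
  CBI : forall s, cC s · cB · cI = cI :> A;
  BB_B : forall s,
    (cB · cB) ∘ cB = (cC s · cB · cB) ∘ (cB ∘ cB) :> A;
  CC_inv : forall e, cC e ∘ cC (~~ e) = cI :> A;
  BC_BB : forall s e,
    (cB · cC e) ∘ (cB ∘ cB) = (cC s · cB · cC e) ∘ (cB ∘ cB) :> A;
  C_braid : forall e,
    (cB · cC e) ∘ (cC e ∘ (cB · cC e)) =
    cC e ∘ ((cB · cC e) ∘ cC e) :> A;
  BB_C : forall e,
    (cB · cB) ∘ cC e = cC e ∘ ((cB · cC e) ∘ cB) :> A }.

Record bci_alg := BciAlg {
  bci_of :> bci_data;
  bci_algP : is_extensional_bci bci_of }.

Record is_bci_mor (A A' : bci_data) (h : A -> A') : Prop := IsBciMor {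
  bmor_app : forall a b, h (a · b) = h a · h b;
  bmor_B : h cB = cB;
  bmor_C : forall s, h (cC s) = cC s;
  bmor_I : h cI = cI }.

Definition bci_mor (A A' : bci_data) := {h : A -> A' | is_bci_mor h}.

Lemma bci_mor_eq (A A' : bci_data) (f g : bci_mor A A') :
  sval f =1 sval g -> f = g.
Proof. by case: f g => [f fP] [g gP] /= /funext; exact: eq_exist. Qed.

Program Definition bci_mor_id (A : bci_data) : bci_mor A A := fun a => a.
Next Obligation. by move=> A; split. Qed.

Program Definition bci_mor_comp (A B D : bci_data)
  (g : bci_mor B D) (f : bci_mor A B) : bci_mor A D :=
  fun a => sval g (sval f a).
Next Obligation.
move=> A B D [g [ga gB gC gI]] [f [fa fB fC fI]] /=; split => /=.
- by move=> a b; rewrite fa ga.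
- by rewrite fB gB.
- by move=> s; rewrite fC gC.
- by rewrite fI gI.
Qed.

Program Definition bci_category : category :=
  @Category bci_alg (fun A A' => bci_mor A A') (fun A => bci_mor_id A)
    (fun A B D g f => bci_mor_comp g f) _ _ _.
Next Obligation. by move=> *; exact: bci_mor_eq. Qed.
Next Obligation. by move=> *; exact: bci_mor_eq. Qed.
Next Obligation. by move=> *; exact: bci_mor_eq. Qed.

(** Elements of the Artin braid group on [n] strands are represented by words
    in the generators: [(i, true)] is the generator σ_(i+1), crossing the
    strands [i] and [i+1] (numbered from 0), and [(i, false)] is its inverse.
    The product is concatenation, and two words represent the same braid iff
    they are related by [braid_eq]. *)
Definition braid (n : nat) := seq ('I_n.-1 * bool).

Inductive braid_eq (n : nat) : braid n -> braid n -> Prop :=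
  | braid_refl s : braid_eq s s
  | braid_sym s t : braid_eq s t -> braid_eq t s
  | braid_trans s t u : braid_eq s t -> braid_eq t u -> braid_eq s u
  | braid_cat s s' t t' :
      braid_eq s s' -> braid_eq t t' -> braid_eq (s ++ t) (s' ++ t')
  | braid_inv (i : 'I_n.-1) e : braid_eq [:: (i, e); (i, ~~ e)] [::]
  | braid_far (i j : 'I_n.-1) : i.+1 < j ->
      braid_eq [:: (i, true); (j, true)] [:: (j, true); (i, true)]
  | braid_artin (i j : 'I_n.-1) : i.+1 = j ->
      braid_eq [:: (i, true); (j, true); (i, true)]
               [:: (j, true); (i, true); (j, true)].

Lemma strand0_proof n (i : 'I_n.-1) : i < n.
Proof. exact: leq_trans (ltn_ord i) (leq_pred n). Qed.

Lemma strand1_proof n (i : 'I_n.-1) : i.+1 < n.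
Proof. by rewrite -ltn_predRL. Qed.

Definition strand0 n (i : 'I_n.-1) : 'I_n := Ordinal (strand0_proof i).
Definition strand1 n (i : 'I_n.-1) : 'I_n := Ordinal (strand1_proof i).

(** The word is reversed because [(p * q)%g i = q (p i)] for MathComp
    permutations, whereas the underlying permutation of a product of braids
    [s ++ t] is to be [i |-> braid_perm s (braid_perm t i)], as required by the
    equivariance of right actions. *)
Definition braid_perm n (s : braid n) : {perm 'I_n} :=
  (\prod_(l <- rev s) tperm (strand0 l.1) (strand1 l.1))%g.

Definition offset k (j : 'I_k -> nat) (i : nat) := \sum_(m < k | m < i) j m.

Lemma block_letter_proof k (j : 'I_k -> nat) (i : 'I_k) (l : 'I_(j i).-1) :
  offset j i + l < (\sum_(m < k) j m).-1.
Proof.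
rewrite ltn_predRL [ltnRHS](bigID (fun m : 'I_k => m < i)) /= -addnS ltn_add2l.
by rewrite (bigD1 i) ?ltnn //= ltn_addr // strand1_proof.
Qed.

(** The block sum [t_0 ⊕ ... ⊕ t_(k-1)]. *)
Definition braid_sum k (j : 'I_k -> nat) (t : forall i, braid (j i)) :
    braid (\sum_(i < k) j i) :=
  flatten [seq [seq (Ordinal (block_letter_proof l.1), l.2) | l <- t i]
          | i <- enum 'I_k].

Lemma cross_letter_proof k (j : 'I_k -> nat) (p : {perm 'I_k}) (i : 'I_k.-1)
    (u : 'I_(j (p (strand1 i)))) (v : 'I_(j (p (strand0 i)))) :
  offset (fun m => j (p m)) i + u + v < (\sum_(m < k) j m).-1.
Proof.
rewrite ltn_predRL (reindex_inj (@perm_inj _ p)) /=.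
rewrite [ltnRHS](bigID (fun m : 'I_k => m < i)) /= -addnA -addnS ltn_add2l.
rewrite (bigD1 (strand0 i)) ?ltnn //= (bigD1 (strand1 i)) /=; last first.
  by rewrite -leqNgt leqnSn /= -val_eqE /= eqn_leq ltnn.
rewrite addnA ltn_addr // [ltnRHS]addnC -addSn.
by rewrite -addnS leq_add.
Qed.

(** With [k] blocks of parallel strands, of which the one at position [m] has
    size [j (p m)], the blocks at positions [i] and [i+1] cross, every
    strand of the former crossing every strand of the latter, with sign [e]. *)
Definition block_cross k (j : 'I_k -> nat) (p : {perm 'I_k}) (i : 'I_k.-1)
    (e : bool) : braid (\sum_(m < k) j m) :=
  [seq (Ordinal (cross_letter_proof u v), e)
  | u <- rev (enum 'I_(j (p (strand1 i)))), v <- enum 'I_(j (p (strand0 i)))].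

(** [cable s j] is [s[j_0, ..., j_(k-1)]]. In a product of braids the last
    letter acts first on the strands, so the letter [l] in [l :: w] meets the
    blocks as rearranged by [w]. *)
Fixpoint cable k (s : braid k) (j : 'I_k -> nat) : braid (\sum_(m < k) j m) :=
  if s is l :: w
  then block_cross j (braid_perm w)^-1%g l.1 l.2 ++ cable w j
  else [::].

(** A tuple of operations of possibly different arities is a function from an
    ordinal to [{n & op n}]. *)
Record cbo_data := CboData {
  op :> nat -> Type;
  oid : op 1;
  ocomp : forall k, op k -> forall g : 'I_k -> {n & op n},
    op (\sum_(i < k) tag (g i));
  oact : forall n, op n -> braid n -> op n;
  oapp : op 2;
  olam : forall n, op n.+1 -> op n }.

Arguments oid {_}.
Arguments ocomp {_ k}.
Arguments oact {_ n}.
Arguments oapp {_}.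
Arguments olam {_ n}.

(** An operation together with its arity. Equations between operations whose
    arities are only provably equal are stated between such packages. *)
Notation pack P x := (@existT nat (op P) _ x).

Definition cast_op (P : nat -> Type) m n (e : m = n) (x : P m) : P n :=
  eq_rect m P x n e.

Lemma pack_inj (P : nat -> Type) n (x y : P n) :
  existT P n x = existT P n y -> x = y.
Proof.
move=> e; have := projT2_eq e; move: (projT1_eq e) => /= e1.
by rewrite (Prop_irrelevance e1 erefl).
Qed.

Lemma pack_cast (P : nat -> Type) m n (e : m = n) (x : P m) :
  existT P n (cast_op e x) = existT P m x.
Proof. by case: n / e. Qed.

Section OperadOps.
Variable P : cbo_data.

Definition pair_family (x y : {n & P n}) (i : 'I_2) : {n & P n} :=
  if i == ord0 then x else y.

Lemma sum_pair_family (x y : {n & P n}) :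
  \sum_(i < 2) tag (pair_family x y i) = tag x + tag y.
Proof. by rewrite big_ord_recl big_ord1. Qed.

Definition oapp2 m n (x : P m) (y : P n) : P (m + n) :=
  cast_op (sum_pair_family (pack P x) (pack P y))
    (ocomp oapp (pair_family (pack P x) (pack P y))).

End OperadOps.

Lemma sum_braid_perm k (p : {perm 'I_k}) (j : 'I_k -> nat) :
  \sum_(i < k) j (p i) = \sum_(i < k) j i.
Proof. by rewrite [RHS](reindex_inj (@perm_inj _ p)). Qed.

Record is_operad (P : cbo_data) : Prop := IsOperad {
  ocomp1o : forall n (f : P n),
    pack P (ocomp oid (fun _ : 'I_1 => pack P f)) = pack P f;
  ocompo1 : forall k (f : P k),
    pack P (ocomp f (fun _ : 'I_k => pack P oid)) = pack P f;
  ocompA : forall k (f : P k) (g : 'I_k -> {n & P n})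
      (h : forall i, 'I_(tag (g i)) -> {n & P n}),
    pack P (ocomp (ocomp f g)
      (fun s : 'I_(\sum_i tag (g i)) => h (tagnat.sig1 s) (tagnat.sig2 s))) =
    pack P (ocomp f (fun i => pack P (ocomp (tagged (g i)) (h i)))) }.

Record is_braided (P : cbo_data) : Prop := IsBraided {
  oact_eq : forall n (f : P n) (s t : braid n),
    braid_eq s t -> oact f s = oact f t;
  oact1 : forall n (f : P n), oact f [::] = f;
  oactM : forall n (f : P n) (s t : braid n),
    oact f (s ++ t) = oact (oact f s) t;
  ocomp_actl : forall k (f : P k) (s : braid k) (g : 'I_k -> {n & P n}),
    ocomp (oact f s) g =
    oact (cast_op (sum_braid_perm (braid_perm s)^-1%g (fun i => tag (g i)))
            (ocomp f (fun i => g ((braid_perm s)^-1%g i))))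
         (cable s (fun i => tag (g i)));
  ocomp_actr : forall k (f : P k) (g : 'I_k -> {n & P n})
      (t : forall i, braid (tag (g i))),
    ocomp f (fun i => pack P (oact (tagged (g i)) (t i))) =
    oact (ocomp f g) (braid_sum t) }.

Record is_closed (P : cbo_data) : Prop := IsClosed {
  olamK : forall n (p : P n.+1), pack P (oapp2 (olam p) oid) = pack P p;
  olam_uniq : forall n (p : P n.+1) (q : P n),
    pack P (oapp2 q oid) = pack P p -> q = olam p }.

Record is_closed_braided_operad (P : cbo_data) : Prop := IsCBO {
  cbo_operadP : is_operad P;
  cbo_braidedP : is_braided P;
  cbo_closedP : is_closed P }.

Record cb_operad := CbOperad {
  cbo_of :> cbo_data;
  cb_operadP : is_closed_braided_operad cbo_of }.

Record is_cbo_mor (P Q : cbo_data) (h : forall n, P n -> Q n) : Prop :=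
    IsCboMor {
  omor_id : h 1 oid = oid;
  omor_comp : forall k (f : P k) (g : 'I_k -> {n & P n}),
    h _ (ocomp f g) = ocomp (h k f) (fun i => pack Q (h _ (tagged (g i))));
  omor_act : forall n (f : P n) (s : braid n), h n (oact f s) = oact (h n f) s;
  omor_app : h 2 oapp = oapp }.

Definition cbo_mor (P Q : cbo_data) := {h : forall n, P n -> Q n | is_cbo_mor h}.

Lemma cbo_mor_eq (P Q : cbo_data) (f g : cbo_mor P Q) :
  (forall n x, sval f n x = sval g n x) -> f = g.
Proof.
case: f g => [f fP] [g gP] /= fg; apply: eq_exist.
by apply: functional_extensionality_dep => n; apply: funext.
Qed.

Program Definition cbo_mor_id (P : cbo_data) : cbo_mor P P := fun n x => x.
Next Obligation.
move=> P; split=> // k f g; apply: pack_inj.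
pose T (g : 'I_k -> {n & P n}) := pack P (ocomp f g).
suff e : g = fun i => pack P (tagged (g i)) by exact: (congr1 T e).
by apply: funext => i; case: (g i).
Qed.

Program Definition cbo_mor_comp (P Q R : cbo_data)
  (g : cbo_mor Q R) (f : cbo_mor P Q) : cbo_mor P R :=
  fun n x => sval g n (sval f n x).
Next Obligation.
move=> P Q R [g [gi gc gs ga]] [f [fi fc fs fa]] /=; split => /=.
- by rewrite fi gi.
- by move=> k x xs; rewrite fc;
  exact: (gc _ _ (fun i => pack Q (f _ (tagged (xs i))))).
- by move=> n x s; rewrite fs gs.
- by rewrite fa ga.
Qed.

Program Definition cbo_category : category :=
  @Category cb_operad (fun P Q => cbo_mor P Q) (fun P => cbo_mor_id P)
    (fun P Q R g f => cbo_mor_comp g f) _ _ _.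
Next Obligation. by move=> *; exact: cbo_mor_eq. Qed.
Next Obligation. by move=> *; exact: cbo_mor_eq. Qed.
Next Obligation. by move=> *; exact: cbo_mor_eq. Qed.

(** [cB], [cC e] and [cI] are the closures of the operations [x (y z)],
    [x z y] and [x]; the braid in [cC e] is the block sum of the trivial braid
    on one strand and the generator of sign [e] on two strands. *)
Definition nullary_data (P : cbo_data) : bci_data := {|
  carrier := P 0;
  app := fun a b : P 0 => oapp2 a b;
  cB := olam (olam (olam (oapp2 oid oapp)));
  cC := fun e => olam (olam (olam
    (oact (oapp2 oapp oid) [:: (Ordinal (isT : 1 < 2), e)])));
  cI := olam oid |}.

Section NullaryMor.
Variables (P Q : cb_operad) (h : cbo_mor P Q).

Lemma mor_pack m n (x : P m) (y : P n) :
  pack P x = pack P y -> pack Q (sval h m x) = pack Q (sval h n y).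
Proof.
by move=> /(congr1 (fun z : {n & P n} => pack Q (sval h _ (tagged z)))).
Qed.

Lemma mor_oapp2 m n (x : P m) (y : P n) :
  sval h _ (oapp2 x y) = oapp2 (sval h m x) (sval h n y).
Proof.
apply: pack_inj; rewrite pack_cast.
rewrite (mor_pack (pack_cast (sum_pair_family (pack P x) (pack P y)) _)).
have [_ hc _ ha] := proj2_sig h.
rewrite hc ha.
pose T (g : 'I_2 -> {n & Q n}) := pack Q (ocomp oapp g).
suff e : (fun i => pack Q (sval h _ (tagged (pair_family (pack P x) (pack P y) i))))
  = pair_family (pack Q (sval h m x)) (pack Q (sval h n y)) by exact: (congr1 T e).
by apply: funext => i; rewrite /pair_family; case: ifP.
Qed.

Lemma mor_olam n (p : P n.+1) : sval h n (olam p) = olam (sval h n.+1 p).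
Proof.
apply: (olam_uniq (cbo_closedP (cb_operadP Q))).
have [hi _ _ _] := proj2_sig h.
rewrite -{1}hi -mor_oapp2; apply: mor_pack.
exact: (olamK (cbo_closedP (cb_operadP P))).
Qed.

Lemma nullary_morP :
  @is_bci_mor (nullary_data P) (nullary_data Q) (sval h 0).
Proof.
have [hi _ hs ha] := proj2_sig h.
split => /=.
- by move=> a b; exact: (@mor_oapp2 0 0 a b).
- by rewrite !mor_olam (@mor_oapp2 1 2 oid oapp) hi ha.
- by move=> e; rewrite !mor_olam hs (@mor_oapp2 2 1 oapp oid) hi ha.
- by rewrite mor_olam hi.
Qed.

End NullaryMor.

Definition nullary_well_defined :=
  forall P : cb_operad, is_extensional_bci (nullary_data P).

Program Definition nullary_functor (H : nullary_well_defined) :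
    functor cbo_category bci_category :=
  @Functor cbo_category bci_category (fun P => BciAlg (H P))
    (fun P Q h => exist _ (sval h 0) (nullary_morP h)) _ _.
Next Obligation. by move=> *; exact: bci_mor_eq. Qed.
Next Obligation. by move=> *; exact: bci_mor_eq. Qed.

Fixpoint Bpow (A : bci_data) (k : nat) : A :=
  if k is k'.+1 then cB ∘ Bpow A k' else cI.
Arguments Bpow {A}.

Definition internal_pred (A : bci_data) (m : nat) (f : A) : Prop :=
  exists a : A, f = a^• ∘ Bpow m.

Definition internal_op (A : bci_data) (m : nat) := {f : A | internal_pred m f}.

Definition internal_comp (A : bci_data) k (f : A) (g : 'I_k -> A) : A :=
  \big[(fun x y => x ∘ y)/f]_(i < k) (Bpow i · g i).

(** The generator σ_(i+1) of sign [e] acts by composition with [B^i C^e], which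
    exchanges the arguments [i] and [i+1]. *)
Definition internal_act (A : bci_data) n (f : A) (s : braid n) : A :=
  foldl (fun x (l : 'I_n.-1 * bool) => (Bpow l.1 · cC l.2) ∘ x) f s.

Section InternalClosure.
Variable A : bci_alg.
Implicit Types (a b c f g x y z : A) (s e : bool).

Let appB := appB (bci_algP A).
Let appC := appC (bci_algP A).
Let appI := appI (bci_algP A).
Let BI := BI (bci_algP A).
Let CBI := CBI (bci_algP A).
Let BB_B := BB_B (bci_algP A).
Let CC_inv := CC_inv (bci_algP A).
Let BC_BB := BC_BB (bci_algP A).
Let BB_C := BB_C (bci_algP A).

Lemma appC_true s a b : cC s · a · b = cC true · a · b.
Proof. by case: s => //; rewrite (appC_sign (bci_algP A)). Qed.

Lemma B_comp x y : cB · (x ∘ y) = (cB · x) ∘ (cB · y).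
Proof.
have := congr1 (fun F : A => F · x · y) (BB_B true).
by rewrite !appB !appC !appB.
Qed.

Lemma bcompA x y z : (x ∘ y) ∘ z = x ∘ (y ∘ z).
Proof. by rewrite B_comp appB. Qed.

Lemma bcomp1 x : cI ∘ x = x.
Proof. by rewrite BI appI. Qed.

Lemma bcompI x : x ∘ cI = x.
Proof. by have := congr1 (fun F => F · x) (CBI true); rewrite appC appI. Qed.

Lemma B_B x : cB ∘ (cB · x) = (cB · (cB · x)) ∘ cB.
Proof.
have := congr1 (fun F : A => F · x) (BB_B true).
by rewrite !appB !appC.
Qed.

Lemma B_C s f x : cB · (cC s · f · x) = cC s · (cC s ∘ (cB · f)) · x.
Proof.
have := congr1 (fun F : A => F · f · x) (BB_C s).
by rewrite !appB.
Qed.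

Lemma C_comp s f x y : (cC s · f · x) ∘ y = cC s · (f ∘ y) · x.
Proof. by rewrite B_C appC appB. Qed.

Lemma B_o_C s : cB ∘ cC (~~ s) =
  (cB · cC (~~ s)) ∘ (cC (~~ s) ∘ (cB · cB)) :> A.
Proof.
have CC : cC (~~ s) ∘ cC s = cI :> A by have := CC_inv (~~ s); rewrite negbK.
rewrite -[in RHS](bcompI (cB · cB)) -(CC_inv s) -(bcompA (cB · cB)) BB_C.
rewrite -(bcompA (cC (~~ s))) -(bcompA (cC (~~ s))) CC bcomp1.
by rewrite -!bcompA -B_comp CC BI bcomp1.
Qed.

Lemma C_o f y s : (cC s · f) ∘ y = cC s · ((cC s · cB · y) ∘ f).
Proof.
have := congr1 (fun F : A => F · f · y) (B_o_C (~~ s)).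
by rewrite negbK !appB -C_comp.
Qed.

Lemma C_BB s x : cC s ∘ (cB · (cB · x)) = (cB · (cB · x)) ∘ cC s.
Proof.
have := congr1 (fun F : A => F · x) (BC_BB s s).
by rewrite !appB !appC.
Qed.

Lemma C_Bo s x f z : cC s · ((cB · x) ∘ f) · z = x ∘ (cC s · f · z).
Proof.
by have := congr1 (fun F : A => F · f · z) (C_BB s x); rewrite !appB.
Qed.

Lemma bulE a y : a^• ∘ y = cC true · y · a.
Proof. by rewrite C_comp bcomp1. Qed.

Lemma bul_B a x : a^• ∘ (cB · x) = x ∘ a^•.
Proof. by rewrite bulE -C_Bo bcompI. Qed.

Lemma bul_swap c x y z :
  x ∘ (c^• ∘ (y ∘ z)) = c^• ∘ (((cB · x) ∘ y) ∘ z).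
Proof. by rewrite -bcompA -bul_B !bcompA. Qed.

Lemma B_bul a : cB · a^• = cC true · cC true · a.
Proof. by rewrite B_C BI bcompI. Qed.

Lemma C_app s f x a : cC s · f · (x · a) = cC s · ((cC s · cB · x) ∘ f) · a.
Proof. by rewrite -C_o appB. Qed.

Lemma bul_app x a : (x · a)^• = a^• ∘ (cC true · cB · x).
Proof. by rewrite C_app bcompI bulE. Qed.

Lemma CB_B z : (cC true · cB · (cB · z)) ∘ cB = cB ∘ (cC true · cB · z).
Proof. by rewrite C_app C_comp bcompA -BB_B C_Bo. Qed.

Lemma CB_anti x y :
  cC true · cB · (x ∘ y) = (cC true · cB · y) ∘ (cC true · cB · x).
Proof. by rewrite C_app CB_B C_comp. Qed.

Lemma CB_com x z :
  (cB · x) ∘ (cC true · cB · z) = (cC true · cB · z) ∘ (cB · x).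
Proof. by rewrite -C_Bo -B_B C_comp. Qed.

Lemma bul_nat a : (cB · a^•) ∘ cB = cC true · cB · a^•.
Proof.
rewrite B_bul C_comp [RHS]C_app; congr (cC true · _ · a).
by rewrite C_app C_comp bcompA -BC_BB C_Bo -C_comp CBI bcomp1.
Qed.

Lemma B_BB z w : (cB · (cB · z)) ∘ (cB ∘ w) = cB ∘ ((cB · z) ∘ w).
Proof. by rewrite -!bcompA B_B. Qed.

Lemma BpowS k : Bpow k.+1 = cB ∘ Bpow k :> A.
Proof. by []. Qed.

Lemma Bpow_app k x : Bpow k.+1 · x = cB · (Bpow k · x).
Proof. by rewrite /= appB. Qed.

Lemma BpowD m n : Bpow (m + n) = Bpow m ∘ Bpow n :> A.
Proof.
by elim: m => [|m IH] /=; rewrite ?bcomp1 // IH bcompA.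
Qed.

Lemma Bpow_nat m :
  (cB · Bpow m) ∘ cB = (cC true · cB · Bpow m) ∘ Bpow m.+1 :> A.
Proof.
elim: m => [|m IH]; first by rewrite /= BI CBI !bcomp1 bcompI.
have e : Bpow m.+1 = Bpow m ∘ cB :> A by rewrite -addn1 BpowD /= bcompI.
rewrite [in LHS]e B_comp bcompA (BB_B true) -bcompA CB_com bcompA.
rewrite -(bcompA _ cB) IH bcompA -bcompA -CB_anti -e.
by rewrite -[m.+2]addn1 BpowD /= bcompI.
Qed.

Lemma op_nat m f : internal_pred m f ->
  (cB · f) ∘ cB = (cC true · cB · f) ∘ Bpow m.
Proof.
move=> [a ->]; rewrite B_comp bcompA Bpow_nat -bcompA CB_com bcompA /=.
by rewrite -(bcompA _ cB) bul_nat -bcompA -CB_anti.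
Qed.

Lemma op_nat_pow m f i : internal_pred m f ->
  (Bpow i.+1 · f) ∘ Bpow i.+1 =
  (cC true · cB · (Bpow i · f)) ∘ Bpow (i + m).
Proof.
move=> fP; elim: i => [|i IH]; first by rewrite Bpow_app /= bcompI appI (op_nat fP).
rewrite 2!Bpow_app BpowS B_BB -Bpow_app IH Bpow_app addSn BpowS.
by rewrite -!bcompA CB_B.
Qed.

Lemma C_nat_pow s i :
  (Bpow i.+1 · cC s) ∘ Bpow i.+2 =
  (cC true · cB · (Bpow i · cC s)) ∘ Bpow i.+2 :> A.
Proof.
elim: i => [|i IH].
  rewrite Bpow_app /= bcompI appI; exact: BC_BB.
rewrite 2!Bpow_app BpowS B_BB -Bpow_app IH Bpow_app [in RHS]BpowS.
by rewrite -!bcompA CB_B.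
Qed.

Lemma internal_comp_step i m r f g :
  internal_pred m f -> internal_pred (i.+1 + r) g ->
  internal_pred (i + m + r) ((Bpow i · f) ∘ g).
Proof.
move=> fP [c ->]; exists ((Bpow i · f) · c).
rewrite bul_app bcompA (BpowD (i + m)) -(bcompA _ (Bpow (i + m))).
by rewrite -op_nat_pow // (Bpow_app i f) -bul_swap (BpowD i.+1).
Qed.

Lemma internal_act_step s i m f : i.+1 < m -> internal_pred m f ->
  internal_pred m ((Bpow i · cC s) ∘ f).
Proof.
move=> /subnKC <- [c ->]; exists ((Bpow i · cC s) · c).
rewrite bul_app bcompA (BpowD i.+2) -[in RHS](bcompA _ (Bpow i.+2)).
by rewrite -C_nat_pow (Bpow_app i (cC s)) -bul_swap.
Qed.

Lemma internal_compP i k (f : 'I_k -> A) (j : 'I_k -> nat) g :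
  (forall l, internal_pred (j l) (f l)) -> internal_pred (i + k) g ->
  internal_pred (i + \sum_(l < k) j l)
    (\big[(fun x y => x ∘ y)/g]_(l < k) (Bpow (i + l) · f l)).
Proof.
elim: k i f j => [|k IH] i f j fP gP; first by rewrite !big_ord0.
rewrite !big_ord_recl addn0 addnA; apply: internal_comp_step => //.
rewrite (eq_bigr (fun l : 'I_k => Bpow (i.+1 + l) · f (lift ord0 l))); last first.
  by move=> l _; rewrite lift0 addnS.
by apply: IH => //; rewrite addSnnS.
Qed.

Lemma internal_idP : internal_pred 1 (cI : A).
Proof. by exists cI; rewrite bulE /= bcompI CBI. Qed.

Lemma internal_appP : internal_pred 2 (cB : A).
Proof. by exists cI; rewrite bulE /= bcompI -C_comp CBI bcomp1. Qed.

Lemma internal_actP m f (s : braid m) : internal_pred m f ->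
  internal_pred m (internal_act f s).
Proof.
rewrite /internal_act.
elim: s f => //= l s IH f fP; apply/IH/internal_act_step => //.
exact: strand1_proof.
Qed.

End InternalClosure.

Section Internal.
Variable A : bci_alg.

Program Definition internal_data : cbo_data := {|
  op := internal_op A;
  oid := (cI : A);
  ocomp := fun k f g =>
    internal_comp (sval f) (fun i => sval (tagged (g i)));
  oact := fun n f s => internal_act (sval f) s;
  oapp := (cB : A);
  (* if [f = a^• ∘ B^(n+1)] then [f · I = a] *)
  olam := fun n f => (sval f · cI)^• ∘ Bpow n |}.
Next Obligation. exact: internal_idP. Qed.
Next Obligation.
move=> k [f fP] g /=; apply: (@internal_compP A 0) => // i.
exact: proj2_sig.
Qed.
Next Obligation. by move=> n [f fP] s; exact: internal_actP. Qed.
Next Obligation. exact: internal_appP. Qed.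
Next Obligation. by move=> n [f fP]; exists (f · cI). Qed.

End Internal.

Section InternalMor.
Variables (A A' : bci_alg) (h : bci_mor A A').

Lemma bci_mor_Bpow k : sval h (Bpow k) = Bpow k.
Proof.
have [happ hB _ hI] := proj2_sig h.
by elim: k => //= k IH; rewrite !happ hB IH.
Qed.

Lemma internal_morP m (f : A) : internal_pred m f -> internal_pred m (sval h f).
Proof.
have [happ hB hC hI] := proj2_sig h.
by move=> [a ->]; exists (sval h a); rewrite !happ hB hC hI bci_mor_Bpow.
Qed.

Definition internal_mor_fun n (f : internal_op A n) : internal_op A' n :=
  exist _ (sval h (sval f)) (internal_morP (proj2_sig f)).

Lemma internal_mor_funP :
  @is_cbo_mor (internal_data A) (internal_data A') internal_mor_fun.
Proof.
have [happ hB hC hI] := proj2_sig h.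
split.
- exact: eq_exist.
- move=> k f g; apply: eq_exist; rewrite /= /internal_comp.
  apply: (big_ind2 (fun x y => sval h x = y)) => // [x x' y y' <- <-|i _].
    by rewrite !happ hB.
  by rewrite happ bci_mor_Bpow.
- move=> n f s; apply: eq_exist; rewrite /= /internal_act.
  elim: s (sval f) => //= l s IH x.
  by rewrite IH !happ hB hC bci_mor_Bpow.
- exact: eq_exist.
Qed.

Definition internal_mor : cbo_mor (internal_data A) (internal_data A') :=
  exist _ internal_mor_fun internal_mor_funP.

End InternalMor.

Definition internal_well_defined :=
  forall A : bci_alg, is_closed_braided_operad (internal_data A).

Program Definition internal_functor (H : internal_well_defined) :
    functor bci_category cbo_category :=
  @Functor bci_category cbo_category (fun A => CbOperad (H A))
    (fun A A' h => internal_mor h) _ _.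
Next Obligation.
by move=> H A; apply: cbo_mor_eq => n [x xP]; exact: eq_exist.
Qed.
Next Obligation.
by move=> H A A' A'' g f; apply: cbo_mor_eq => n x; exact: eq_exist.
Qed.

(* Main.v *)
From HB Require Import structures.
From mathcomp Require Import all_boot all_order all_fingroup.
From mathcomp Require Import boolp.
Require Import Defs.

(** In the internal operad, composing with an operation [f = a^• ∘ B^m] turns one
    argument into [m] arguments, so [f ∘ B x = B^m x ∘ f] and [f ∘ C^e] equals
    [B f] followed by [m] crossings. The operad axioms are instances of these
    two rules: composites are products [(B^0 g_0) ∘ (B^1 g_1) ∘ ... ∘ f] and
    braids act by products of the [B^i C^e], both over the same monoid.

    In a closed braided operad [P], extend [app] to operations of all arities by
    [x y = app(x, y)]. Then [B x y z = x (y z)] holds for all operations, and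
    [C^e x y z] is [x z y] acted on by the strands of [z] crossing those of [y];
    [x] is determined by [x id]. The equations of [P(0)] follow by applying both
    sides to enough copies of [id].

    The unit of the adjunction is [a |-> a^•]. The counit maps
    [f = a^• ∘ B^n] with [a] in [P(0)] to [a id ... id] ([n] times). It is a
    morphism because [(f x) id ... id = x (counit f)] for every operation [x]. A
    morphism out of an internal operad is determined by its nullary component,
    as it commutes with λ-abstraction. *)

Set Implicit Arguments.
Unset Strict Implicit.
Unset Printing Implicit Defensive.
Local Open Scope bci_scope.

(** * Braid words *)

(** Letters are plain naturals, so words of braids whose strand numbers are only provably equal can
    be compared without casts. *)
Definition letters := seq (nat * bool).

Definition word n (s : braid n) : letters := [seq (val l.1, l.2) | l <- s].

Definition restrict n (w : letters) : braid n :=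
  pmap (fun l => omap (fun i => (i, l.2)) (insub l.1)) w.

Definition shift d (w : letters) : letters := [seq (d + l.1, l.2) | l <- w].

(** Letters for a block of [n1] strands crossing one of [n0] strands, [d] strands
    being on their left. *)
Definition cross_word d n0 n1 (e : bool) : letters :=
  [seq (d + u + v, e) | u <- rev (iota 0 n1), v <- iota 0 n0].

Definition swap_nat a i := if i == a then a.+1 else if i == a.+1 then a else i.

Lemma cross_word0 d n e : cross_word d 0 n e = [::].
Proof. by rewrite /cross_word; elim: (rev _). Qed.

Lemma word_inj n : injective (@word n).
Proof. by apply: inj_map => -[i e] [j f] [/val_inj -> ->]. Qed.

Lemma restrictK n w : all (fun l => l.1 < n.-1) w -> word (restrict n w) = w.
Proof.
elim: w => //= -[i e] w IH /= /andP [lt_i /IH {IH}].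
by rewrite /restrict /= insubT /= => ->.
Qed.

Lemma wordK n : cancel (@word n) (@restrict n).
Proof.
move=> s; apply/word_inj/restrictK; apply/allP => _ /mapP [l _ ->] /=.
exact: ltn_ord.
Qed.

Lemma word_cat n (s t : braid n) : word (s ++ t) = word s ++ word t.
Proof. exact: map_cat. Qed.

Lemma restrict_cat n w w' : restrict n (w ++ w') = restrict n w ++ restrict n w'.
Proof. exact: pmap_cat. Qed.

Lemma offsetE k (n : nat -> nat) i :
  i <= k -> offset (fun m : 'I_k => n m) i = \sum_(m < i) n m.
Proof. by move=> le_i; rewrite (big_ord_widen k n le_i). Qed.

Lemma word_lt n (s : braid n) : all (fun l => l.1.+1 < n) (word s).
Proof. by apply/allP => _ /mapP [l _ ->] /=; exact: strand1_proof. Qed.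

Lemma word_braid_sum k (j : 'I_k -> nat) (t : forall i, braid (j i))
    (n : nat -> nat) (w : nat -> letters) :
  (forall i, j i = n i) -> (forall i, word (t i) = w i) ->
  word (braid_sum t) =
  flatten [seq shift (\sum_(m < i) n m) (w i) | i <- iota 0 k].
Proof.
move=> jn tw; rewrite /word /braid_sum map_flatten -map_comp.
rewrite -val_enum_ord -map_comp; congr flatten; apply: eq_map => i /=.
rewrite -tw /shift /word -!map_comp; apply: eq_map => l /=.
rewrite -(@offsetE k n i); last exact: ltnW.
by congr (_ + _, _); apply: eq_bigr => m _; rewrite jn.
Qed.

Lemma braid_perm1 n (l : 'I_n.-1 * bool) :
  braid_perm [:: l] = tperm (strand0 l.1) (strand1 l.1).
Proof. by rewrite /braid_perm big_seq1. Qed.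

Lemma braid_perm_cons n (l : 'I_n.-1 * bool) (s : braid n) :
  braid_perm (l :: s) = (braid_perm s * tperm (strand0 l.1) (strand1 l.1))%g.
Proof. by rewrite /braid_perm rev_cons -cats1 big_cat big_seq1. Qed.

Lemma val_tperm n (i : 'I_n.-1) (j : 'I_n) :
  val (tperm (strand0 i) (strand1 i) j) = swap_nat i j.
Proof.
rewrite /swap_nat; case: tpermP => [->|->|/eqP + /eqP +] /=.
- by rewrite eqxx.
- by rewrite eqn_leq ltnn eqxx.
by rewrite -!val_eqE /= => /negbTE -> /negbTE ->.
Qed.

Lemma word_block_cross k (j : 'I_k -> nat) (p : {perm 'I_k}) (i : 'I_k.-1) e
    (n : nat -> nat) :
  (forall m, j (p m) = n m) ->
  word (block_cross j p i e) = cross_word (\sum_(m < i) n m) (n i) (n i.+1) e.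
Proof.
move=> jn; have /= <- := jn (strand0 i); have /= <- := jn (strand1 i).
rewrite /word /block_cross map_allpairs /cross_word.
rewrite -!val_enum_ord -map_rev allpairs_mapl allpairs_mapr.
apply: eq_allpairs => // u v /=.
rewrite -(@offsetE k n i); last exact/ltnW/strand0_proof.
by congr (_ + _ + _, _); rewrite /offset; apply: eq_bigr => m _.
Qed.

(** * Composition in a [BC^±I]-algebra *)

(** A head constant for the notation [∘], to which the monoid structure behind the iterated products
    is attached. *)
Definition compose (A : bci_alg) (x y : A) : A := x ∘ y.

HB.instance Definition _ (A : bci_alg) :=
  SemiGroup.isLaw.Build A (@compose A) (fun x y z => esym (bcompA x y z)).
HB.instance Definition _ (A : bci_alg) :=
  Monoid.isMonoidLaw.Build A cI (@compose A) (@bcomp1 A) (@bcompI A).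

Section InternalOperad.
Variable A : bci_alg.
Implicit Types (a b c f x y z : A) (e : bool) (w : letters) (g h : nat -> A).

Let appB := appB (bci_algP A).
Let appC := appC (bci_algP A).
Let appI := appI (bci_algP A).
Let BI := BI (bci_algP A).
Let CC_inv := CC_inv (bci_algP A).
Let BB_C := BB_C (bci_algP A).

Notation "\comp_ ( i < k ) F" := (\big[@compose A/cI]_(i < k) F)
  (at level 41, i, k at level 50, F at level 41).

(** A word acts by left composition with this element. Later letters stand further left, so a right
    action results and concatenation reverses products. *)
Definition braid_comb w : A :=
  foldl (fun x l => (Bpow l.1 · cC l.2) ∘ x) cI w.

Lemma composeE x y : compose x y = x ∘ y.
Proof. by []. Qed.

Lemma internal_compE k f (g : 'I_k -> A) :
  internal_comp f g = (\comp_(i < k) (Bpow i · g i)) ∘ f.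
Proof.
rewrite /internal_comp unlock /=.
elim: index_enum => [|i r IH] /=; first by rewrite bcomp1.
by rewrite IH -bcompA.
Qed.

Lemma braid_comb_foldl w f :
  foldl (fun x l => (Bpow l.1 · cC l.2) ∘ x) f w = braid_comb w ∘ f.
Proof.
rewrite -[in LHS](bcomp1 f) /braid_comb; move: (cI : A) => x.
by elim: w x => //= l w IH x; rewrite -bcompA IH.
Qed.

Lemma internal_actE m f (s : braid m) :
  internal_act f s = braid_comb (word s) ∘ f.
Proof.
rewrite -braid_comb_foldl /internal_act /word.
by elim: s f => //= l s IH f; rewrite IH.
Qed.

Lemma braid_comb1 i e : braid_comb [:: (i, e)] = Bpow i · cC e.
Proof. by rewrite /braid_comb /= bcompI. Qed.

Lemma braid_comb_cat w w' : braid_comb (w ++ w') = braid_comb w' ∘ braid_comb w.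
Proof. by rewrite {1}/braid_comb foldl_cat braid_comb_foldl. Qed.

Lemma braid_comb_cons i e w :
  braid_comb ((i, e) :: w) = braid_comb w ∘ (Bpow i · cC e).
Proof. by rewrite -cat1s braid_comb_cat braid_comb1. Qed.

Lemma Bpow_comp k x y : Bpow k · (x ∘ y) = (Bpow k · x) ∘ (Bpow k · y).
Proof.
elim: k => [|k IH]; first by rewrite /= !appI.
by rewrite !Bpow_app IH B_comp.
Qed.

Lemma Bpow_I k : Bpow k · cI = cI :> A.
Proof.
elim: k => [|k IH]; first by rewrite /= appI.
by rewrite Bpow_app IH BI.
Qed.

Lemma Bpow0 x : Bpow 0 · x = x.
Proof. exact: appI. Qed.

Lemma Bpow_add i k x : Bpow (i + k) · x = Bpow i · (Bpow k · x).
Proof. by rewrite BpowD appB. Qed.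

Lemma Bpow_appr k x : Bpow k.+1 · x = Bpow k · (cB · x).
Proof. by rewrite -addn1 Bpow_add /= bcompI. Qed.

Lemma braid_comb_shift d w : Bpow d · braid_comb w = braid_comb (shift d w).
Proof.
elim/last_ind: w => [|w [i e] IH]; first by rewrite Bpow_I.
by rewrite /shift map_rcons -!cats1 !braid_comb_cat Bpow_comp IH !braid_comb1
  Bpow_add.
Qed.

(** * Passing elements through operations *)

Lemma op_pass m f x : internal_pred m f -> f ∘ (cB · x) = (Bpow m · x) ∘ f.
Proof.
move=> fP; have := congr1 (fun F => F · x) (op_nat fP).
by rewrite !appB appC.
Qed.

Lemma Bpow_op_pass i m f x : internal_pred m f ->
  (Bpow i · f) ∘ (Bpow i.+1 · x) = (Bpow (i + m) · x) ∘ (Bpow i · f).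
Proof.
move=> fP; rewrite -addn1 !Bpow_add -!Bpow_comp; congr (_ · _).
by rewrite [Bpow 1]/= bcompI (op_pass _ fP).
Qed.

Lemma C_pass i e x :
  (Bpow i · cC e) ∘ (Bpow i.+2 · x) = (Bpow i.+2 · x) ∘ (Bpow i · cC e).
Proof.
by rewrite -addn2 !Bpow_add -!Bpow_comp [Bpow 2]/= bcompI appB C_BB.
Qed.

Lemma braid_comb_far d w x : all (fun l => l.1.+1 < d) w ->
  braid_comb w ∘ (Bpow d · x) = (Bpow d · x) ∘ braid_comb w.
Proof.
elim: w => [|[i e] w IH] /=; first by rewrite /braid_comb bcomp1 bcompI.
move=> /andP [lt_i /IH {}IH].
rewrite braid_comb_cons bcompA -(subnKC lt_i) Bpow_add C_pass.
by rewrite -Bpow_add (subnKC lt_i) -!bcompA IH.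
Qed.

Lemma comp_pass k g (n : nat -> nat) x : (forall i, internal_pred (n i) (g i)) ->
  (\comp_(i < k) (Bpow i · g i)) ∘ (Bpow k · x) =
  (Bpow (\sum_(i < k) n i) · x) ∘ \comp_(i < k) (Bpow i · g i).
Proof.
move=> gP; elim: k x => [|k IH] x; first by rewrite !big_ord0 bcomp1 bcompI.
rewrite !big_ord_recr /= !composeE bcompA (Bpow_op_pass _ _ (gP k)).
by rewrite -!bcompA (Bpow_add k) IH -Bpow_add.
Qed.

(** Associativity of operadic composition. In the induction on [k], the block of [h] that feeds the
    last operation moves past all earlier [g i] by [comp_pass] and lands next to [g k]. *)
Lemma comp_reassoc k g (n : nat -> nat) h :
  (forall i, internal_pred (n i) (g i)) ->
  (\comp_(s < \sum_(i < k) n i) (Bpow s · h s)) ∘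
    (\comp_(i < k) (Bpow i · g i)) =
  \comp_(i < k) (Bpow i ·
    ((\comp_(l < n i) (Bpow l · h (\sum_(m < i) n m + l))) ∘ g i)).
Proof.
move=> gP; elim: k => [|k IH]; first by rewrite !big_ord0 bcomp1.
rewrite !big_ord_recr big_split_ord /= !composeE -IH Bpow_comp.
under [X in (_ ∘ X) ∘ _]eq_bigr => l _ do rewrite Bpow_add.
rewrite -(big_morph _ (@Bpow_comp (\sum_(i < k) n i)) (Bpow_I _)).
by rewrite bcompA -(bcompA (Bpow _ · _)) -(comp_pass _ _ gP) !bcompA.
Qed.

(** Equivariance for block sums. The last braid moves left past the earlier operations by
    [comp_pass], then past the earlier braids, which only touch strands to its left. *)
Lemma comp_act k g (n : nat -> nat) (t : nat -> letters) :
  (forall i, internal_pred (n i) (g i)) ->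
  (forall i, all (fun l => l.1.+1 < n i) (t i)) ->
  \comp_(i < k) (Bpow i · (braid_comb (t i) ∘ g i)) =
  braid_comb (flatten [seq shift (\sum_(m < i) n m) (t i) | i <- iota 0 k]) ∘
    (\comp_(i < k) (Bpow i · g i)).
Proof.
move=> gP tP; elim: k => [|k IH]; first by rewrite !big_ord0 bcomp1.
rewrite -[in iota _ _]addn1 iotaD map_cat flatten_cat /= cats0.
rewrite !big_ord_recr /=.
rewrite !composeE IH Bpow_comp braid_comb_cat -braid_comb_shift.
rewrite bcompA -(bcompA (\comp_(i < k) _)) (comp_pass _ _ gP) !bcompA.
rewrite -(bcompA (braid_comb _)) braid_comb_far ?bcompA //.
(* A letter of block [j < k] stays below the total size of the first [k] blocks. *)
apply/allP => -[i e] /flattenP /= [_ /mapP [j + ->] /mapP [[l f] ltl [-> _]]].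
rewrite mem_iota add0n => /= lt_j.
have /= lt_l := allP (tP j) _ ltl.
rewrite -(subnKC lt_j) big_split_ord /= big_ord_recr /=.
by rewrite -addnS ltn_addr // ltn_add2l.
Qed.

(** * Naturality of the crossings *)

Lemma bul_C a e : a^• ∘ cC e = cB · a^•.
Proof.
have := B_C e cI a; rewrite BI bcompI.
by rewrite !appC_true bulE => ->.
Qed.

(** With [bul_C], this is the arity 0 case of [B_op_C] and [op_C]: an operation without arguments
    leaves no strand to cross. *)
Lemma B_bul_C a e : (cB · a^•) ∘ cC e = a^•.
Proof.
by rewrite -(bul_C a (~~ e)) bcompA -[in cC e](negbK e) CC_inv bcompI.
Qed.

(** This is [cross_word 0 m 1 e], and its reverse is [cross_word 0 1 m e]: the crossings of a single
    strand with [m] parallel ones. *)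
Definition strand_word m e : letters := [seq (v, e) | v <- iota 0 m].

Lemma strand_wordS m e :
  strand_word m.+1 e = (0, e) :: shift 1 (strand_word m e).
Proof.
rewrite /strand_word /= /shift -map_comp -[in LHS]add1n iotaDl -map_comp.
by congr (_ :: _); apply: eq_map.
Qed.

Lemma rev_strand_wordS m e :
  rev (strand_word m.+1 e) = rcons (shift 1 (rev (strand_word m e))) (0, e).
Proof. by rewrite strand_wordS rev_cons /shift map_rev. Qed.

Lemma cross_wordS m n e :
  cross_word 0 m n.+1 e = shift 1 (cross_word 0 m n e) ++ strand_word m e.
Proof.
rewrite /cross_word /= rev_cons -cats1 -[in LHS]add1n iotaDl -map_rev.
rewrite allpairs_cat /= cats0 /shift map_allpairs allpairs_mapl.
by congr (_ ++ _); apply: eq_allpairs.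
Qed.

Lemma shift_cross d m n e : shift d (cross_word 0 m n e) = cross_word d m n e.
Proof.
by rewrite /shift map_allpairs; apply: eq_allpairs => // u v /=; rewrite addnA.
Qed.

Lemma braid_comb_strandS m e : braid_comb (strand_word m.+1 e) =
  (cB · braid_comb (strand_word m e)) ∘ cC e.
Proof.
rewrite strand_wordS braid_comb_cons -braid_comb_shift Bpow0.
by rewrite [Bpow 1]/= bcompI.
Qed.

Lemma braid_comb_rev_strandS m e : braid_comb (rev (strand_word m.+1 e)) =
  cC e ∘ (cB · braid_comb (rev (strand_word m e))).
Proof.
rewrite rev_strand_wordS -cats1 braid_comb_cat braid_comb1.
by rewrite -braid_comb_shift Bpow0 [Bpow 1]/= bcompI.
Qed.

(** Iterates [B_o_C]: each factor [B] doubles one of the crossing strands and so adds one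
    crossing. *)
Lemma Bpow_C m e :
  Bpow m ∘ cC e = braid_comb (strand_word m.+1 e) ∘ (cB · Bpow m).
Proof.
elim: m => [|m IH].
  rewrite braid_comb_strandS /= BI.
  by rewrite bcompI appI bcomp1.
rewrite BpowS bcompA IH !braid_comb_strandS.
rewrite !bcompA (B_comp cB) (B_comp (cB · _)) !bcompA.
rewrite -(bcompA cB (cB · _)) B_B !bcompA.
have := B_o_C A (~~ e); rewrite negbK => BC.
by rewrite -(bcompA cB) BC !bcompA.
Qed.

(** For [f = a^• ∘ B^m], the factor [B^m] produces [m + 1] crossings, and [a^•] absorbs one of them
    by [bul_C]. *)
Lemma op_C m f e : internal_pred m f ->
  f ∘ cC e = braid_comb (strand_word m e) ∘ (cB · f).
Proof.
move=> [a ->]; rewrite bcompA Bpow_C braid_comb_strandS !bcompA.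
by rewrite -(bcompA _ (cB · _)) bul_B bcompA -(bcompA _ (cC e)) bul_C -B_comp.
Qed.

Lemma B_Bpow_C m e :
  (cB · Bpow m) ∘ cC e = braid_comb (rev (strand_word m.+1 e)) ∘ Bpow m.
Proof.
elim: m => [|m IH].
  rewrite braid_comb_rev_strandS /= BI.
  by rewrite !bcompI bcomp1.
rewrite BpowS B_comp bcompA IH !braid_comb_rev_strandS.
rewrite bcompA -(bcompA (cB · cB)) BB_C !bcompA.
by rewrite -(bcompA cB (cB · _)) B_B (B_comp (cC e)) !bcompA.
Qed.

Lemma B_op_C m f e : internal_pred m f ->
  (cB · f) ∘ cC e = braid_comb (rev (strand_word m e)) ∘ f.
Proof.
move=> [a ->]; rewrite B_comp bcompA B_Bpow_C braid_comb_rev_strandS bcompA.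
by rewrite -(bcompA _ (cC e)) B_bul_C -(bcompA _ (cB · _)) bul_B bcompA.
Qed.

Lemma op_rev_strand m n f e : internal_pred m f ->
  f ∘ braid_comb (rev (strand_word n e)) =
  braid_comb (cross_word 0 m n e) ∘ (Bpow n · f).
Proof.
move=> fP; elim: n => [|n IH].
  by rewrite Bpow0 bcomp1 bcompI.
rewrite braid_comb_rev_strandS -bcompA (op_C _ fP) bcompA -B_comp IH.
rewrite cross_wordS braid_comb_cat -braid_comb_shift (Bpow_app n).
by rewrite [Bpow 1]/= bcompI [RHS]bcompA -B_comp.
Qed.

(** Naturality of the braiding in both arguments: [x] spreads the crossing over its [n] strands by
    [B_op_C], then [f] spreads each of these over [m] strands. *)
Lemma op_cross m n f x e : internal_pred m f -> internal_pred n x ->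
  f ∘ ((cB · x) ∘ cC e) = braid_comb (cross_word 0 m n e) ∘ (x ∘ (cB · f)).
Proof.
move=> fP xP; rewrite (B_op_C _ xP) -bcompA (op_rev_strand _ _ fP).
by rewrite bcompA -(op_pass _ xP).
Qed.

(** The factors beyond [a + 1] commute with the crossing by [C_pass], the two at [a] and [a + 1] are
    exchanged by [op_cross], and the resulting braid leaves the earlier factors by [comp_pass]. *)
Lemma comp_cross k g (n : nat -> nat) (a : nat) e :
  (forall i, internal_pred (n i) (g i)) -> a.+1 < k ->
  (\comp_(i < k) (Bpow i · g i)) ∘ (Bpow a · cC e) =
  braid_comb (cross_word (\sum_(m < a) n m) (n a) (n a.+1) e) ∘
    \comp_(i < k) (Bpow i · g (swap_nat a i)).
Proof.
move=> gP /subnKC <-; move: (k - a.+2) => r; rewrite !big_split_ord /=.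
have swap_far i : (i < a) || (a.+1 < i) -> swap_nat a i = i.
  rewrite /swap_nat; case: eqP => [->|_]; first by rewrite ltnn ltnNge leqnSn.
  by case: eqP => // ->; rewrite ltnn ltnNge leqnSn.
rewrite [X in _ = _ ∘ compose _ X](eq_bigr (fun i : 'I_r =>
  Bpow (a.+2 + i) · g (a.+2 + i))) => [|i _]; last first.
  by rewrite swap_far // leq_addr orbT.
rewrite (eq_bigr (fun i : 'I_r => Bpow a.+2 · (Bpow i · g (a.+2 + i))));
  last by move=> i _; rewrite -(Bpow_add a.+2).
rewrite -(big_morph _ (@Bpow_comp a.+2) (Bpow_I _)).
set R := \comp_(i < r) _; rewrite !big_ord_recr /= !composeE.
rewrite [X in _ = _ ∘ ((X ∘ _) ∘ _) ∘ _](eq_bigr (fun i : 'I_a =>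
  Bpow i · g i)) => [|i _]; last by rewrite swap_far // ltn_ord.
rewrite /swap_nat eqxx eqn_leq ltnn eqxx andFb.
set P := \comp_(i < a) _.
rewrite bcompA -C_pass -[LHS]bcompA -[RHS]bcompA; congr (_ ∘ _).
rewrite !(Bpow_appr a) !bcompA -!Bpow_comp (op_cross _ (gP a) (gP a.+1)).
rewrite Bpow_comp -bcompA (comp_pass _ _ gP) bcompA.
by rewrite braid_comb_shift shift_cross.
Qed.
End InternalOperad.

(** * The internal operad *)

Definition extend T (d : T) k (g : 'I_k -> T) (i : nat) : T :=
  if insub i is Some j then g j else d.

Lemma extendE T (d : T) k (g : 'I_k -> T) (i : 'I_k) : extend d g i = g i.
Proof. by rewrite /extend valK. Qed.

Lemma extend_sig T k (n : 'I_k -> nat) (N : nat -> nat) (d : T)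
    (h : forall i, 'I_(n i) -> T) (i : 'I_k) (l : 'I_(n i)) :
  (forall i, n i = N i) ->
  extend d (fun s => h (tagnat.sig1 s) (tagnat.sig2 s))
    (\sum_(m < i) N m + l) = h i l.
Proof.
move=> nN; rewrite -(@offsetE k N i); last exact/ltnW.
rewrite /offset -(eq_bigr _ (fun m _ => nN m)) -tagnat.RankEsum extendE.
by rewrite /tagnat.sig1 /tagnat.sig2 /tagnat.Rank tagnat.rankK.
Qed.

Lemma big_ord_sum T (idx : T) (op : Monoid.law idx) k (n : nat -> nat)
    (F : nat -> T) :
  \big[op/idx]_(s < \sum_(i < k) n i) F s =
  \big[op/idx]_(i < k) \big[op/idx]_(l < n i) F (\sum_(m < i) n m + l).
Proof.
elim: k => [|k IH]; first by rewrite !big_ord0.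
by rewrite !big_ord_recr big_split_ord /= IH.
Qed.

Section InternalWellDefined.
Variable A : bci_alg.
Let I := internal_data A.
Implicit Types (x y : {n & I n}) (e : bool).

Lemma internal_op_inj n (x y : I n) : sval x = sval y -> x = y.
Proof. by case: x y => [x xP] [y yP] /= xy; exact: eq_exist. Qed.

Lemma internal_pack_eq x y :
  tag x = tag y -> sval (tagged x) = sval (tagged y) -> x = y.
Proof.
case: x y => m x [n y] /= e; case: n / e y => y xy; congr existT.
exact: internal_op_inj.
Qed.

Lemma sval_cast_op m n (e : m = n) (x : I m) : sval (cast_op e x) = sval x.
Proof. by case: n / e. Qed.

(** Since the default value is itself an operation, the arity hypotheses of [comp_reassoc],
    [comp_act] and [comp_cross] hold at every index. *)
Definition tuple_ext k (g : 'I_k -> {n & I n}) : nat -> {n & I n} :=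
  extend (pack I (oid : I 1)) g.

Lemma sval_ocomp k (f : I k) (g : 'I_k -> {n & I n}) :
  sval (ocomp f g) =
  (\big[@compose A/cI]_(i < k) (Bpow i · sval (tagged (tuple_ext g i)))) ∘ sval f.
Proof.
rewrite /= internal_compE; congr (_ ∘ _).
by apply: eq_bigr => i _; rewrite /tuple_ext extendE.
Qed.

Lemma internal_operadP : is_operad I.
Proof.
split.
- move=> n f; apply: internal_pack_eq => /=; first by rewrite big_ord1.
  by rewrite internal_compE big_ord1 Bpow0 bcompI.
- move=> k f; apply: internal_pack_eq => /=; first by rewrite sum1_card card_ord.
  by rewrite internal_compE big1 ?bcomp1 // => i _; rewrite Bpow_I.
move=> k f g h; set h' := fun s => h _ _.
have gE (i : 'I_k) : tag (g i) = tag (tuple_ext g i).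
  by rewrite /tuple_ext extendE.
have hE (i : 'I_k) (l : 'I_(tag (g i))) :
  tuple_ext h' (\sum_(m < i) tag (tuple_ext g m) + l) = h i l.
  exact: (@extend_sig _ _ _ (fun m => tag (tuple_ext g m))).
have gP i := proj2_sig (tagged (tuple_ext g i)).
apply: internal_pack_eq.
- rewrite /=.
  transitivity (\sum_(s < \sum_(i < k) tag (tuple_ext g i)) tag (tuple_ext h' s)).
    rewrite -(eq_bigr _ (fun i _ => gE i)).
    by apply: eq_bigr => s _; rewrite /tuple_ext extendE.
  rewrite [LHS](@big_ord_sum _ _ addn _ (fun i => tag (tuple_ext g i))
    (fun s => tag (tuple_ext h' s))).
  apply: eq_bigr => i _; rewrite -gE; apply: eq_bigr => l _.
  by rewrite hE.
- change (sval (ocomp (ocomp f g) h') = sval (ocomp f (fun i =>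
    pack I (ocomp (tagged (g i)) (h i))))).
  rewrite !sval_ocomp -bcompA; move: (tuple_ext h') hE => H hE.
  rewrite (eq_bigr _ (fun i _ => gE i)).
  rewrite (comp_reassoc k (fun s => sval (tagged (H s))) gP).
  congr (_ ∘ _); apply: eq_bigr => i _.
  have -> : tuple_ext g i = g i by exact: extendE.
  rewrite /tuple_ext extendE /=.
  rewrite internal_compE.
  by congr (_ · (_ ∘ _)); apply: eq_bigr => l _; rewrite hE.
Qed.

Lemma sval_oact n (f : I n) (s : braid n) :
  sval (oact f s) = braid_comb A (word s) ∘ sval f.
Proof. exact: internal_actE. Qed.

(** Inverses come from [CC_inv], distant commutation from [C_pass] and the Artin relation from
    [C_braid], each carried to position [i] by [B^i]. *)
Lemma braid_comb_eq n (s t : braid n) : braid_eq s t ->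
  braid_comb A (word s) = braid_comb A (word t).
Proof.
have H := bci_algP A.
elim=> {s t} [//|s t _ ->|s t u _ -> _ ->|s s' t t' _ es _ et|i e|i j lt
  |i j e] //.
- by rewrite !word_cat !braid_comb_cat es et.
- rewrite /= !braid_comb_cons /braid_comb /= bcomp1 -Bpow_comp.
  by rewrite -[in X in _ ∘ cC X](negbK e) (CC_inv H) Bpow_I.
- rewrite /= !braid_comb_cons /braid_comb /= !bcomp1.
  by rewrite -(subnKC lt) (Bpow_add i.+2) C_pass.
rewrite /= -e !braid_comb_cons /braid_comb /= !bcomp1 !(Bpow_appr i).
by rewrite -!Bpow_comp !bcompA (C_braid H).
Qed.

(** The tail of the word is composed leftmost, hence meets the operations first; the head letter
    then crosses blocks already rearranged by the tail, exactly as in [cable]. *)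
Lemma comp_braid k (g : 'I_k -> {n & I n}) (s : braid k) :
  (\big[@compose A/cI]_(i < k) (Bpow i · sval (tagged (g i)))) ∘
    braid_comb A (word s) =
  braid_comb A (word (cable s (fun i => tag (g i)))) ∘
    \big[@compose A/cI]_(i < k)
      (Bpow i · sval (tagged (g ((braid_perm s)^-1%g i)))).
Proof.
elim: s => [|[l e] s IH].
  rewrite bcomp1 bcompI /braid_perm big_nil invg1.
  by apply: eq_bigr => i _; rewrite perm1.
rewrite /= word_cat braid_comb_cat braid_comb_cons -bcompA IH !bcompA.
congr (_ ∘ _); set p := (braid_perm s)^-1%g.
pose G := tuple_ext (fun i => g (p i)).
have GE (i : 'I_k) : G i = g (p i) by exact: extendE.
have GP i := proj2_sig (tagged (G i)).
rewrite (@word_block_cross _ _ _ _ _ (fun i => tag (G i))); last first.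
  by move=> m; rewrite GE.
rewrite [X in X ∘ _ = _](eq_bigr
  (fun i : 'I_k => Bpow i · sval (tagged (G i))));
  last by move=> i _; rewrite GE.
rewrite (comp_cross _ GP (strand1_proof l)); congr (_ ∘ _).
apply: eq_bigr => i _; rewrite braid_perm_cons invMg tpermV permM.
by rewrite -/p -val_tperm GE.
Qed.

Lemma internal_braidedP : is_braided I.
Proof.
split.
- move=> n f s t st; apply: internal_op_inj; rewrite !sval_oact.
  by rewrite (braid_comb_eq st).
- by move=> n f; apply: internal_op_inj; rewrite sval_oact /= bcomp1.
- move=> n f s t; apply: internal_op_inj.
  by rewrite !sval_oact word_cat braid_comb_cat bcompA.
- move=> k f s g; apply: internal_op_inj.
  rewrite sval_oact sval_cast_op /= !internal_compE.
  by rewrite internal_actE -[LHS]bcompA comp_braid bcompA.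
move=> k f g t; apply: internal_op_inj.
rewrite sval_oact sval_ocomp (sval_ocomp f g) -bcompA.
congr (_ ∘ _); pose w := extend [::] (fun i => word (t i)).
have gE (i : 'I_k) : tuple_ext g i = g i by exact: extendE.
rewrite (@word_braid_sum _ _ _ (fun i => tag (tuple_ext g i)) w); first last.
- by move=> i; rewrite /w extendE.
- by move=> i; rewrite gE.
have gP i := proj2_sig (tagged (tuple_ext g i)).
rewrite -(comp_act _ gP) => [|i].
  apply: eq_bigr => i _; rewrite /w /tuple_ext !extendE /=.
  by rewrite internal_actE.
rewrite /w /extend /tuple_ext /extend; case: insubP => //= j _ _.
exact: word_lt.
Qed.

Lemma sval_olam n (p : I n.+1) : sval (olam p) = (sval p · cI)^• ∘ Bpow n.
Proof. by []. Qed.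

Lemma sval_oapp2 m n (x : I m) (y : I n) :
  sval (oapp2 x y) = sval x ∘ ((cB · sval y) ∘ cB).
Proof.
rewrite /oapp2 sval_cast_op /= internal_compE !big_ord_recl big_ord0 /=.
by rewrite !composeE appI ?bcompI ?bcompA //; exact: bci_algP.
Qed.

Lemma bul_Bpow_I (a : A) m : (a^• ∘ Bpow m) · cI = a.
Proof. by have H := bci_algP A; rewrite (appB H) Bpow_I (appC H) !(appI H). Qed.

Lemma internal_predE m (f : A) : internal_pred m f -> (f · cI)^• ∘ Bpow m = f.
Proof. by move=> [a ->]; rewrite bul_Bpow_I. Qed.

(** As [B I = I], [app(q, id)] is [q ∘ B], whose value at [I] is again [q · I]. By [internal_predE]
    this value determines an operation of given arity. *)
Lemma internal_closedP : is_closed I.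
Proof.
have H := bci_algP A; split=> n p.
- apply: internal_pack_eq => /=; first exact: addn1.
  rewrite sval_oapp2 /= (BI H) bcomp1 bcompA.
  have -> : Bpow n ∘ cB = Bpow n.+1 :> A by rewrite -addn1 BpowD /= bcompI.
  exact/internal_predE/(proj2_sig p).
- move=> q /(congr1 (fun z => sval (tagged z))) /=; rewrite sval_oapp2 /= => pq.
  apply: internal_op_inj; rewrite /= -pq (BI H) bcomp1 (appB H) (BI H).
  exact/esym/internal_predE/(proj2_sig q).
Qed.

Lemma internal_cboP : is_closed_braided_operad I.
Proof.
by split; [exact: internal_operadP | exact: internal_braidedP
  | exact: internal_closedP].
Qed.
End InternalWellDefined.

(** * Closed braided operads *)

Section Packages.
Variable P : cb_operad.
Let T := {n & P n}.
Let operadP := cbo_operadP (cb_operadP P).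
Let braidedP := cbo_braidedP (cb_operadP P).
Let closedP := cbo_closedP (cb_operadP P).
Implicit Types (f x y z : T) (g h : nat -> T) (w : letters) (e : bool).

(** Operations of [P] packed with their arity, so that no equation needs a cast.
    In [pcomp f g] only the values of [g] below the arity of [f] matter, and
    [pact x w] drops the letters of [w] that are out of range for [x]. *)
Definition pcomp f g : T :=
  pack P (ocomp (tagged f) (fun i : 'I_(tag f) => g i)).
Definition papp x y : T := pack P (oapp2 (tagged x) (tagged y)).
Definition pact x w : T := pack P (oact (tagged x) (restrict (tag x) w)).
Definition pid : T := pack P (oid : P 1).

Lemma packE x : pack P (tagged x) = x.
Proof. by case: x. Qed.

Lemma pack_ocomp_eq k (f : P k) (g h : 'I_k -> T) :
  g =1 h -> pack P (ocomp f g) = pack P (ocomp f h).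
Proof. by move=> /funext ->. Qed.

Lemma pcomp_eq f g h : (forall i, i < tag f -> g i = h i) ->
  pcomp f g = pcomp f h.
Proof. by move=> gh; apply: pack_ocomp_eq => i; exact: gh. Qed.

Lemma pappE x y :
  papp x y = pcomp (pack P oapp) (fun i => if i is 0 then x else y).
Proof.
rewrite /papp /oapp2 pack_cast; apply: pack_ocomp_eq => -[[|i] lt_i];
  exact: packE.
Qed.

Lemma pcomp_idl g : pcomp pid g = g 0.
Proof.
rewrite -[RHS]packE -(ocomp1o operadP (tagged (g 0))).
by apply: pack_ocomp_eq => i; rewrite packE ord1.
Qed.

Lemma pcomp_idr f : pcomp f (fun=> pid) = f.
Proof. by rewrite /pcomp (ocompo1 operadP) packE. Qed.

Lemma pcompA f g h :
  pcomp (pcomp f g) h =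
  pcomp f (fun i => pcomp (g i) (fun l => h (\sum_(m < i) tag (g m) + l))).
Proof.
rewrite -[RHS](@ocompA _ operadP _ (tagged f) (fun i : 'I_(tag f) => g i)
  (fun i l => h (\sum_(m < i) tag (g m) + l))).
apply: pack_ocomp_eq => s; rewrite [in LHS](tagnat.rect s).
by rewrite -(big_ord_widen (tag f) (fun m => tag (g m))) // ltnW.
Qed.

Lemma pcomp_closed (c : P 0) g : pcomp (pack P c) g = pack P c.
Proof. by rewrite -[RHS]pcomp_idr; exact: pcomp_eq. Qed.

Lemma pcomp_papp x y h :
  pcomp (papp x y) h = papp (pcomp x h) (pcomp y (fun l => h (tag x + l))).
Proof.
rewrite !pappE pcompA; apply: pcomp_eq => -[|[|i]] //= _.
  by apply: pcomp_eq => i _; rewrite big_ord0.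
by apply: pcomp_eq => i _; rewrite big_ord1.
Qed.

Lemma pack_oact n (x : P n) (s : braid n) :
  pack P (oact x s) = pact (pack P x) (word s).
Proof. by rewrite /pact /= wordK. Qed.

Lemma pact_nil x : pact x [::] = x.
Proof. by rewrite /pact (oact1 braidedP) packE. Qed.

Lemma pact_cat x w w' : pact x (w ++ w') = pact (pact x w) w'.
Proof. by rewrite /pact restrict_cat (oactM braidedP). Qed.

Lemma pact_eq n (x : P n) (s t : braid n) : braid_eq s t ->
  pact (pack P x) (word s) = pact (pack P x) (word t).
Proof. by move=> st; rewrite -!pack_oact (oact_eq braidedP _ st). Qed.

(** For [i] out of range both letters are dropped, so no bound on [i] has to be assumed. *)
Lemma pact_inv x i e : pact x [:: (i, e); (i, ~~ e)] = x.
Proof.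
have [lt_i|ge_i] := ltnP i (tag x).-1.
  have := pact_eq (tagged x) (braid_inv (Ordinal lt_i) e).
  by rewrite packE pact_nil.
by rewrite /pact /restrict /= !insubF ?(oact1 braidedP) ?packE // ltnNge ge_i.
Qed.

Definition inverse_word w : letters := rev [seq (l.1, ~~ l.2) | l <- w].

Lemma pactK x w : pact (pact x w) (inverse_word w) = x.
Proof.
elim: w x => [|[i e] w IH] x; first by rewrite !pact_nil.
rewrite /inverse_word /= rev_cons -cats1 pact_cat.
by rewrite -cat1s (pact_cat x) IH -pact_cat pact_inv.
Qed.

Lemma pact_artin x i e : i.+2 < tag x ->
  pact x [:: (i, e); (i.+1, e); (i, e)] =
  pact x [:: (i.+1, e); (i, e); (i.+1, e)].
Proof.
rewrite -ltn_predRL => lt_j; have lt_i := ltnW lt_j.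
have artin y : tag y = tag x ->
    pact y [:: (i, true); (i.+1, true); (i, true)] =
    pact y [:: (i.+1, true); (i, true); (i.+1, true)].
  case: y => n y /= en; subst n.
  exact: (pact_eq y (@braid_artin _ (Ordinal lt_i) (Ordinal lt_j) erefl)).
case: e; first exact: artin.
(* The negative relation is the inverse of the positive one: both words are palindromes, so
   inverting them only flips signs. *)
have := artin (pact x [:: (i.+1, false); (i, false); (i.+1, false)]) erefl.
rewrite (pactK _ [:: (i.+1, false); (i, false); (i.+1, false)]).
pose w := [:: (i, true); (i.+1, true); (i, true)].
move=> /(congr1 (fun z => pact z (inverse_word w))).
by rewrite pactK => ->.
Qed.

Lemma pcomp_actr f g (w : nat -> letters) :
  (forall i, i < tag f -> all (fun l => l.1.+1 < tag (g i)) (w i)) ->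
  pcomp f (fun i => pact (g i) (w i)) =
  pact (pcomp f g)
    (flatten [seq shift (\sum_(m < i) tag (g m)) (w i) | i <- iota 0 (tag f)]).
Proof.
move=> wP; rewrite /pcomp.
have := ocomp_actr braidedP (tagged f) (g := fun i : 'I_(tag f) => g i)
  (fun i => restrict (tag (g i)) (w i)).
move=> /(congr1 (existT (op P) _)) /= ->; rewrite pack_oact; congr pact.
apply: (@word_braid_sum _ _ _ (fun i => tag (g i)) w) => // i; apply: restrictK.
by apply: sub_all (wP i _) => // l; rewrite ltn_predRL.
Qed.

Lemma pcomp_actl f g a e : a.+1 < tag f ->
  pcomp (pact f [:: (a, e)]) g =
  pact (pcomp f (fun i => g (swap_nat a i)))
    (cross_word (\sum_(m < a) tag (g m)) (tag (g a)) (tag (g a.+1)) e).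
Proof.
rewrite -ltn_predRL => lt_a; rewrite /pcomp /=.
rewrite /restrict /= insubT /= (ocomp_actl braidedP) pack_oact pack_cast.
rewrite /= cats0 (@word_block_cross _ _ _ _ _ (fun m => tag (g m))); last first.
  by move=> m; rewrite /braid_perm big_nil invg1 perm1.
congr (pact _ _); apply: pack_ocomp_eq => i.
by rewrite braid_perm1 tpermV val_tperm.
Qed.

Lemma papp_actl x y w : all (fun l => l.1.+1 < tag x) w ->
  papp (pact x w) y = pact (papp x y) w.
Proof.
move=> wP; pose W i := if i is 0 then w else [::].
rewrite !pappE; set g := fun i : nat => if i is 0 then x else y.
rewrite -(@pcomp_eq _ (fun i => pact (g i) (W i))); last first.
  by case=> [|i] _ //=; rewrite pact_nil.
rewrite pcomp_actr; last by case.
congr (pact _ _); rewrite /= !cats0 big_ord0.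
by elim: w {wP W} => //= -[i e] w ->.
Qed.

Lemma papp_actr x y w : all (fun l => l.1.+1 < tag y) w ->
  papp x (pact y w) = pact (papp x y) (shift (tag x) w).
Proof.
move=> wP; pose W i := if i is 0 then [::] else w.
rewrite !pappE; set g := fun i : nat => if i is 0 then x else y.
rewrite -(@pcomp_eq _ (fun i => pact (g i) (W i))); last first.
  by case=> [|i] _ //=; rewrite pact_nil.
rewrite pcomp_actr; last by case.
by rewrite /= cats0 big_ord1.
Qed.

(** The arities agree because application to [pid] adds one to each; then both operations are the
    abstraction of the same [p], by uniqueness. *)
Lemma papp_inj x y : papp x pid = papp y pid -> x = y.
Proof.
case: x y => m x [n y] xy; have mn : m = n.
  by have /= /eqP := congr1 tag xy; rewrite eqn_add2r => /eqP.
subst n; congr existT; pose p : P m.+1 := cast_op (addn1 m) (oapp2 x oid).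
have yp : pack P (oapp2 y oid) = pack P p.
  by rewrite (pack_cast (addn1 m)); exact: (esym xy).
rewrite (olam_uniq closedP yp); apply: (olam_uniq closedP).
by rewrite (pack_cast (addn1 m)).
Qed.

Lemma papp_olam n (p : P n.+1) : papp (pack P (olam p)) pid = pack P p.
Proof. exact: (olamK closedP). Qed.

(** * Combinators of a closed braided operad *)

Notation pcB := (pack P (cB : nullary_data P)).
Notation pcC e := (pack P (cC e : nullary_data P)).
Notation pcI := (pack P (cI : nullary_data P)).

Lemma papp_I x : papp pcI x = x.
Proof.
have := congr1 (fun z => pcomp z (fun=> x)) (papp_olam (oid : P 1)).
by rewrite pcomp_papp pcomp_closed !pcomp_idl.
Qed.

(** Three uses of [papp_olam] give the equation at identities; substituting [x], [y], [z] by
    operadic composition leaves the closed combinator unchanged. *)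
Lemma papp_B x y z : papp (papp (papp pcB x) y) z = papp x (papp y z).
Proof.
have : papp (papp (papp pcB pid) pid) pid = papp pid (pack P oapp).
  by rewrite !papp_olam.
move=> /(congr1 (fun u => pcomp u (nth pid [:: x; y; z]))).
rewrite !pcomp_papp pcomp_closed !pcomp_idl /= => ->; congr papp.
by rewrite pappE; apply: pcomp_eq => -[|[|]].
Qed.

(** Same method as for [papp_B]; under the substitution, equivariance turns the single generator
    into a block crossing. *)
Lemma papp_C e x y z : papp (papp (papp (pcC e) x) y) z =
  pact (papp (papp x z) y) (cross_word (tag x) (tag y) (tag z) e).
Proof.
have : papp (papp (papp (pcC e) pid) pid) pid =
    pact (papp (pack P oapp) pid) [:: (1, e)].
  by rewrite !papp_olam pack_oact.
move=> /(congr1 (fun u => pcomp u (nth pid [:: x; y; z]))).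
rewrite !pcomp_papp pcomp_closed !pcomp_idl /= => ->.
rewrite pcomp_actl // big_ord1; congr pact.
rewrite pcomp_papp pcomp_idl; congr papp.
by rewrite pappE; apply: pcomp_eq => -[|[|]].
Qed.

Lemma pack_app (a b : nullary_data P) :
  pack P (a · b : P 0) = papp (pack P a) (pack P b).
Proof. by []. Qed.

Lemma nullary_bciP : is_extensional_bci (nullary_data P).
Proof.
split.
- by move=> a b c; apply: pack_inj; rewrite !pack_app papp_B.
- by move=> s a b c; apply: pack_inj; rewrite !pack_app papp_C pact_nil.
- by move=> a; apply: pack_inj; rewrite !pack_app papp_I.
- move=> a b; apply: pack_inj; rewrite !pack_app; apply: papp_inj.
  by rewrite !papp_C !pact_nil.
- apply: pack_inj; do 2!apply: papp_inj.
  by rewrite !pack_app !papp_B !papp_I.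
- move=> s; apply: pack_inj; do 2!apply: papp_inj.
  by rewrite !pack_app papp_C pact_nil papp_B !papp_I.
- move=> s; apply: pack_inj; do 4!apply: papp_inj.
  by rewrite !pack_app !papp_B papp_C pact_nil !papp_B.
- move=> e; apply: pack_inj; do 3!apply: papp_inj.
  rewrite !pack_app !papp_B !papp_C papp_I -pact_cat.
  by have := pact_inv (papp (papp pid pid) pid) 1 (~~ e); rewrite negbK.
- move=> s e; apply: pack_inj; do 4!apply: papp_inj.
  rewrite !pack_app !papp_B (papp_C s) pact_nil !papp_B.
  by rewrite !papp_C papp_actr // !papp_B.
- move=> e; apply: pack_inj; do 4!apply: papp_inj.
  rewrite !pack_app; do 4!rewrite ?(papp_B, papp_C) ?papp_actl //.
  (* Strand 0 carries the operation being applied, so the relation lives on strands 1 to 3. *)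
  rewrite -!pact_cat; exact/esym/(@pact_artin _ 1).
- move=> e; apply: pack_inj; do 4!apply: papp_inj.
  rewrite !pack_app; do 4!rewrite ?(papp_B, papp_C) ?papp_actl //.
  by rewrite -!pact_cat.
Qed.
End Packages.

(** * The adjunction *)

Section Counit.
Variable P : cb_operad.
Let A : bci_alg := BciAlg (nullary_bciP P).
Let T := {n & P n}.
Implicit Types (x y : T) (w : letters) (e : bool).

Definition papps n x : T := iter n (fun y => papp y (pid P)) x.

Fixpoint apply_ids n (a : P 0) : P n :=
  if n is m.+1 then cast_op (addn1 m) (oapp2 (apply_ids m a) oid) else a.

(** For [f = a^• ∘ B^n] the element [f · I] is [a], so no witness has to be chosen. *)
Definition counit_fun n (f : internal_op A n) : P n :=
  apply_ids n (sval f · cI : A).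

Lemma pack_apply_ids n (a : P 0) : pack P (apply_ids n a) = papps n (pack P a).
Proof. by elim: n => //= n <-; rewrite pack_cast. Qed.

Lemma pack_counit n (f : internal_op A n) :
  pack P (counit_fun f) =
  papps n (papp (pack P (sval f : P 0)) (pack P (cI : A))).
Proof. exact: pack_apply_ids. Qed.

Lemma tag_papps n x : tag (papps n x) = tag x + n.
Proof. by elim: n => [|n /= ->]; rewrite ?addn0 // addn1 addnS. Qed.

Lemma pappsS n x : papps n.+1 x = papps n (papp x (pid P)).
Proof. exact: iterSr. Qed.

Lemma papps_add m n x : papps (m + n) x = papps n (papps m x).
Proof. by rewrite addnC; exact: iterD. Qed.

Lemma papps_Bpow n x y :
  papps n (papp (papp (pack P (Bpow n : A)) x) y) = papp x (papps n y).
Proof.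
elim: n y => [|n IH] y; first by rewrite /= papp_I.
by rewrite !pappsS -IH BpowS !pack_app !papp_B.
Qed.

(** With [f = a^• ∘ B^n], [f x] becomes [B^n x a], without any braid because [a] has arity 0;
    [papps_Bpow] then moves the identities onto [a]. *)
Lemma papps_op n (f : internal_op A n) x :
  papps n (papp (pack P (sval f : P 0)) x) = papp x (pack P (counit_fun f)).
Proof.
rewrite pack_counit -{1}(internal_predE (proj2_sig f)) -papps_Bpow.
rewrite !pack_app papp_B papp_C (_ : tag (papp _ (pack P (cI : A))) = 0) //.
by rewrite cross_word0 pact_nil papp_I.
Qed.

(** The first block of identities turns [G 0] into an argument by [papps_op]; the [B] in front of
    the other factors lets them act on [y] applied to that argument. *)
Lemma papps_comp k (G : nat -> {n & internal_op A n}) y :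
  papps (\sum_(i < k) tag (G i))
    (papp (pack P (\big[@compose A/cI]_(i < k)
      (Bpow i · sval (tagged (G i))) : P 0)) y) =
  foldl (@papp P) y [seq pack P (counit_fun (tagged (G i))) | i <- iota 0 k].
Proof.
elim: k G y => [|k IH] G y; first by rewrite !big_ord0 /= papp_I.
rewrite !big_ord_recl Bpow0 (eq_bigr (fun i : 'I_k =>
  cB · (Bpow i · sval (tagged (G i.+1))))) => [|i _]; last by rewrite Bpow_app.
rewrite -(big_morph _ (@B_comp A) (BI (bci_algP A))) composeE.
rewrite !pack_app papp_B papps_add papps_op papp_B.
by rewrite [LHS](IH (fun i => G i.+1)) /= (iotaDl 1 0) -map_comp.
Qed.

Lemma pcomp_papps k (a : P 0) (g : nat -> T) :
  pcomp (papps k (pack P a)) g =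
  foldl (@papp P) (pack P a) [seq g i | i <- iota 0 k].
Proof.
elim: k => [|k IH]; first exact: pcomp_closed.
rewrite -[in iota _ _]addn1 iotaD map_cat foldl_cat /= -IH.
by rewrite pcomp_papp pcomp_idl tag_papps addn0.
Qed.

Lemma papps_act n x w : all (fun l => l.1.+1 < tag x) w ->
  papps n (pact x w) = pact (papps n x) w.
Proof.
move=> wP; elim: n => //= n ->; rewrite papp_actl // tag_papps.
by apply: sub_all wP => l lt_l; rewrite ltn_addr.
Qed.

(** [B^i] hands the first [i] identities to [a], [C^e] crosses the next two, and the remaining ones
    do not interact with the braid. *)
Lemma papps_letter n i e (a : P 0) : i.+1 < n ->
  papps n (papp (pack P (Bpow i · cC e : A)) (pack P a)) =
  pact (papps n (pack P a)) [:: (i, e)].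
Proof.
move=> /subnKC <-; rewrite !papps_add -papps_act; last first.
  by rewrite tag_papps /= ltnSn.
congr papps; rewrite /= -/(papps i _) pack_app papps_Bpow papp_C.
by rewrite tag_papps /= /cross_word /= !addn0.
Qed.

Lemma papps_braid_comb n w (f : A) (a : P 0) :
  all (fun l => l.1.+1 < n) w ->
  papps n (papp (pack P (braid_comb A w ∘ f : A)) (pack P a)) =
  pact (papps n (papp (pack P (f : P 0)) (pack P a))) w.
Proof.
elim: w f => [|[i e] w IH] f; first by rewrite bcomp1 pact_nil.
case/andP=> lt_i /IH {}IH; rewrite braid_comb_cons bcompA IH.
rewrite -(cat1s (i, e)) pact_cat; congr pact.
by rewrite -papps_letter // !pack_app papp_B.
Qed.

Lemma papp_ids : papp (pid P) (pid P) = pack P oapp.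
Proof. by rewrite -[RHS]pcomp_idr pappE; apply: pcomp_eq => -[|]. Qed.

Lemma counit_morP : @is_cbo_mor (internal_data A) P counit_fun.
Proof.
split.
- apply: pack_inj; rewrite pack_counit /=.
  by rewrite !papp_I.
- move=> k f g; apply: pack_inj; rewrite pack_counit sval_ocomp.
  have gE (i : 'I_k) : tuple_ext g i = g i by exact: extendE.
  rewrite [X in papps X](eq_bigr (fun i : 'I_k => tag (tuple_ext g i)));
    last by move=> i _; rewrite gE.
  rewrite !pack_app papp_B papps_comp.
  rewrite -[papp (pack P (sval f : P 0)) _]/(pack P (sval f · cI : A)).
  rewrite -(pcomp_papps k _ (fun i =>
    pack P (counit_fun (tagged (tuple_ext g i))))).
  rewrite -pack_apply_ids; apply: (@pack_ocomp_eq P k (counit_fun f)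
    (fun i => pack P (counit_fun (tagged (tuple_ext g i))))
    (fun i => pack P (counit_fun (tagged (g i))))) => i.
  by rewrite gE.
- move=> n f s; apply: pack_inj; rewrite pack_counit sval_oact pack_oact.
  by rewrite papps_braid_comb ?word_lt // pack_counit.
apply: pack_inj; rewrite pack_counit /= papp_B papp_I.
exact: papp_ids.
Qed.

Definition counit : cbo_mor (internal_data A) P := exist _ _ counit_morP.
End Counit.

(** * The unit *)

Section Unit.
Variable A : bci_alg.
Let I : cb_operad := CbOperad (internal_cboP A).

Lemma internal_nullaryP (a : A) : internal_pred 0 (a^• ∘ Bpow 0).
Proof. by exists a. Qed.

Definition unit_fun (a : A) : I 0 :=
  exist _ (a^• ∘ Bpow 0) (internal_nullaryP a).

Lemma unit_morP : @is_bci_mor A (nullary_data I) unit_fun.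
Proof.
have H := bci_algP A.
split.
- move=> a b; apply: internal_op_inj.
  rewrite -[RHS]/(sval (oapp2 (unit_fun a) (unit_fun b))).
  rewrite (@sval_oapp2 A 0 0) /= !bcompI.
  by rewrite -bcompA bul_B bcompA (bulE a) bul_app.
- apply: internal_op_inj.
  rewrite -[RHS]/(sval (olam (olam (olam (oapp2 (oid : I 1) oapp))))).
  (* Nested abstractions collapse: applying an inner one to [I] gives back the element it was built
     from. *)
  rewrite !sval_olam !bul_Bpow_I (@sval_oapp2 A 1 2) /=.
  by rewrite bcomp1 (appB H) (BI H) !bcompI.
- move=> e; apply: internal_op_inj.
  rewrite -[RHS]/(sval (olam (olam (olam (oact (oapp2 oapp (oid : I 1))
    [:: (Ordinal (isT : 1 < 2), e)]))))).
  rewrite !sval_olam !bul_Bpow_I sval_oact (@sval_oapp2 A 2 1) /= braid_comb1 /=.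
  by rewrite !(appB H) !(BI H) !(appI H) (BI H) !bcompI.
by apply: internal_op_inj; rewrite /= (appI H).
Qed.

Definition unit_mor : bci_mor A (nullary_data I) := exist _ _ unit_morP.

Lemma unit_surj (f : I 0) : unit_fun (sval f · cI) = f.
Proof. exact/internal_op_inj/internal_predE/(proj2_sig f). Qed.

Lemma cbo_mor_eq0 (P : cb_operad) (h h' : cbo_mor I P) :
  (forall a, sval h 0 (unit_fun a) = sval h' 0 (unit_fun a)) -> h = h'.
Proof.
move=> hh'; apply: cbo_mor_eq; elim=> [|n IH] f; first by rewrite -(unit_surj f).
have olamK := olamK (cbo_closedP (cb_operadP P)).
by apply: pack_inj; rewrite -!olamK -!mor_olam IH.
Qed.
End Unit.

Theorem theorem5p8 :
  exists (HI : internal_well_defined) (HP : nullary_well_defined),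
    left_adjoint (internal_functor HI) (nullary_functor HP).
Proof.
exists internal_cboP, nullary_bciP.
(* The bijection restricts a morphism to arity 0 and precomposes with the unit. *)
exists (fun A P h => @comp bci_category _ _ _
  (fmap (nullary_functor nullary_bciP) h) (unit_mor A)).
split.
- move=> A P.
  have unitK u a :
      sval (cbo_mor_comp (counit P) (internal_mor u)) 0 (unit_fun a) = sval u a.
    have [uapp _ _ uI] := proj2_sig u.
    (* In arity 0 the counit merely applies to [I], which is [u I], so the computation takes place
       in [A]. *)
    rewrite -[LHS]/(sval u (a^• ∘ Bpow 0) · cI).
    by rewrite -uI -uapp bul_Bpow_I.
  (* The inverse is the usual transpose through the counit; [unitK] gives both cancellations, one of
     them through [cbo_mor_eq0]. *)
  exists (fun u => cbo_mor_comp (counit P) (internal_mor u)).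
    by move=> h; apply: cbo_mor_eq0 => a; rewrite unitK.
  by move=> u; apply: bci_mor_eq => a; exact: unitK.
- move=> A A' P f u; apply: bci_mor_eq => a /=.
  congr (sval f 0 _); apply: internal_op_inj => /=.
  have [uapp uB uC uI] := proj2_sig u.
  by rewrite !uapp uB (uC true) uI.
- by move=> A P Q v f; exact: bci_mor_eq.
Qed.
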